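(* Let $\mathbb{S}^{3,3}=\{x\in\mathbb{R}^{3,4}: g(x,x)=-1\}$ with normal vector $\mathbf n(x)=x$. The Nijenhuis tensor $N_P$ of the almost para-complex Cayley structure $P$ on $\mathbb{S}^{3,3}$ has the form $$N_P(X,Y)=-8\,\mathbf n\times(X\times Y)=-8\,P(X\times Y)$$ for all tangent vectors $X,Y$ to $\mathbb{S}^{3,3}$ at a common point.
   Context: The split Cayley algebra $\mathbf{Ca}'$ is the real vector space of elements $a+be$ with $a,b$ quaternions, with multiplication $(a+be)(c+de)=(ac+\overline d\,b)+(da+b\overline c)e$. With $e_1,e_2,e_3$ the standard quaternion units ($e_1e_2=e_3$), put $e_4=e$, $e_5=e_1e$, $e_6=e_2e$, $e_7=e_3e$. Conjugation is $\overline x=x_0-x_1e_1-\dots-x_7e_7$, and $\langle\cdot,\cdot\rangle$ is the scalar product with quadratic form $x\overline x=x_0^2+x_1^2+x_2^2+x_3^2-x_4^2-x_5^2-x_6^2-x_7^2$. The space $\mathbb{R}^{3,4}=\Im(\mathbf{Ca}')=\mathrm{span}(e_1,\dots,e_7)$ carries the restriction $g$ of $\langle\cdot,\cdot\rangle$, of signature $(3,4)$. The vector cross product is $X\times Y=\Im(XY)=XY+g(X,Y)$. The almost para-complex Cayley structure is $P_x:T_x\mathbb{S}^{3,3}\to T_x\mathbb{S}^{3,3}$, $P_x(Y)=\mathbf n(x)\times Y$ (it satisfies $P^2=\mathrm{Id}$); the expression $P(X\times Y)$ means $\mathbf n\times(X\times Y)$ (the normal component of $X\times Y$ is annihilated by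 $\mathbf n\times$). The Nijenhuis tensor is $$N_P(X,Y)=2\big([X,Y]+[PX,PY]-P[PX,Y]-P[X,PY]\big)$$ for vector fields $X,Y$ on $\mathbb{S}^{3,3}$. *)

(* Defs.v *)
From mathcomp Require Import all_boot all_order all_algebra.
From mathcomp Require Import all_classical all_reals all_analysis.
From mathcomp Require Import ring lra.
Import Order.TTheory GRing.Theory Num.Theory.
Import numFieldNormedType.Exports.

Set Implicit Arguments.
Unset Strict Implicit.
Unset Printing Implicit Defensive.

Local Open Scope classical_set_scope.
Local Open Scope ring_scope.

Section SplitCayley.
Context {R : realType}.

(* The row (a0, a1, a2, a3) is the quaternion a0 + a1 e1 + a2 e2 + a3 e3. *)
Definition mkquat (a0 a1 a2 a3 : R) : 'rV[R]_4 :=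
  \row_(i < 4) [:: a0; a1; a2; a3]`_i.

Definition qmul (a b : 'rV[R]_4) : 'rV[R]_4 :=
  let a0 := a 0 0 in let a1 := a 0 1 in let a2 := a 0 2 in let a3 := a 0 3 in
  let b0 := b 0 0 in let b1 := b 0 1 in let b2 := b 0 2 in let b3 := b 0 3 in
  mkquat (a0 * b0 - a1 * b1 - a2 * b2 - a3 * b3)
         (a0 * b1 + a1 * b0 + a2 * b3 - a3 * b2)
         (a0 * b2 - a1 * b3 + a2 * b0 + a3 * b1)
         (a0 * b3 + a1 * b2 - a2 * b1 + a3 * b0).

Definition qconj (a : 'rV[R]_4) : 'rV[R]_4 :=
  mkquat (a 0 0) (- a 0 1) (- a 0 2) (- a 0 3).

(* The pair (a, b) stands for a + b e. *)
Definition cayley : Type := ('rV[R]_4 * 'rV[R]_4)%type.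

Definition camul (x y : cayley) : cayley :=
  let: (a, b) := x in let: (c, d) := y in
  (qmul a c + qmul (qconj d) b, qmul d a + qmul b (qconj c)).

Definition caconj (x : cayley) : cayley := (qconj x.1, - x.2).

Definition caRe (x : cayley) : R := x.1 0 0.

(* Polarization of the quadratic form x |-> x * caconj x, which is
   real-valued. *)
Definition cadot (x y : cayley) : R :=
  (caRe (camul x (caconj y)) + caRe (camul y (caconj x))) / 2.

(* R^{3,4}: coordinate i : 'I_7 is the coefficient of e_(i+1), where
   e4 = e, e5 = e1 e, e6 = e2 e, e7 = e3 e. *)
Definition ofIm (X : 'rV[R]_7) : cayley :=
  (mkquat 0 (X 0 0) (X 0 1) (X 0 2),
   mkquat (X 0 3) (X 0 4) (X 0 5) (X 0 6)).

Definition caIm (x : cayley) : 'rV[R]_7 :=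
  \row_(i < 7) [:: x.1 0 1; x.1 0 2; x.1 0 3;
                   x.2 0 0; x.2 0 1; x.2 0 2; x.2 0 3]`_i.

Definition gdot (X Y : 'rV[R]_7) : R := cadot (ofIm X) (ofIm Y).

Definition cross (X Y : 'rV[R]_7) : 'rV[R]_7 := caIm (camul (ofIm X) (ofIm Y)).

Lemma mkquatE (a b c d : R) :
  ((mkquat a b c d 0 0 = a) * (mkquat a b c d 0 1 = b) *
   (mkquat a b c d 0 2 = c) * (mkquat a b c d 0 3 = d))%type.
Proof. by rewrite !mxE. Qed.

Lemma gdotE (X Y : 'rV[R]_7) : gdot X Y =
  X 0 0 * Y 0 0 + X 0 1 * Y 0 1 + X 0 2 * Y 0 2
  - X 0 3 * Y 0 3 - X 0 4 * Y 0 4 - X 0 5 * Y 0 5 - X 0 6 * Y 0 6.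
Proof.
have mxD (A B : 'rV[R]_4) i j : (A + B) i j = A i j + B i j by rewrite mxE.
have mxN (A : 'rV[R]_4) i j : (- A) i j = - A i j by rewrite mxE.
rewrite /gdot /cadot /caRe /camul /caconj /ofIm /= !mxD /qmul !mkquatE.
by rewrite /qconj !(mkquatE, mxN); field.
Qed.

End SplitCayley.

Section Smooth.
Context {R : realType} {V W : normedModType R}.

(* Meant for U open: f is C^(k+1) on U when it is differentiable on U and all
   its directional derivatives are C^k on U. *)
Fixpoint Ck_on (k : nat) (U : set V) (f : V -> W) : Prop :=
  match k with
  | 0 => forall x, U x -> {for x, continuous f}
  | k'.+1 => (forall x, U x -> differentiable f x) /\
             (forall v, Ck_on k' U (fun x => 'D_v f x))
  end.

Definition smooth_on (U : set V) (f : V -> W) : Prop :=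
  forall k, Ck_on k U f.

Lemma derive_comp {U : normedModType R} (f : U -> V) (h : V -> W) (x v : U) :
  differentiable f x -> differentiable h (f x) ->
  'D_v (h \o f) x = 'D_('d f x v) h (f x).
Proof.
move=> df dh; rewrite (deriveE v (differentiable_comp df dh)) (deriveE _ dh).
have e := diff_comp df dh.
exact: (congr1 (fun k : U -> W => k v) e).
Qed.

End Smooth.

Section PseudoSphere.
Context {R : realType}.
Implicit Types y p v : 'rV[R]_7.

Definition S33 : set 'rV[R]_7 := [set x | gdot x x = -1].

Definition nvec (x : 'rV[R]_7) : 'rV[R]_7 := x.

(* The tangent space of S33 at x, i.e. the kernel of the differential of
   y |-> gdot y y at x. *)
Definition tangent (x : 'rV[R]_7) : set 'rV[R]_7 := [set v | gdot x v = 0].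

(* Objects on S33 are given by functions on R^{3,4} of which only the
   values on S33 are used. *)
Definition smooth_S33 (X : 'rV[R]_7 -> 'rV[R]_7) : Prop :=
  forall p, S33 p -> exists U F,
    [/\ open U, U p, smooth_on U F & forall y, U y -> S33 y -> X y = F y].

Definition vector_field (X : 'rV[R]_7 -> 'rV[R]_7) : Prop :=
  smooth_S33 X /\ forall p, S33 p -> tangent p (X p).

(* Radial retraction of the open cone gdot y y < 0 onto S33. *)
Definition retr (y : 'rV[R]_7) : 'rV[R]_7 := (Num.sqrt (- gdot y y))^-1 *: y.

(* Derivative at p, along v tangent to S33, of a function f on S33. The
   extension f \o retr of f to a neighbourhood of S33 can be replaced by any
   other one that is differentiable at p: see [derS_ext]. *)
Definition derS (f : 'rV[R]_7 -> 'rV[R]_7) (p v : 'rV[R]_7) : 'rV[R]_7 :=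
  'D_v (f \o retr) p.

Lemma diff_gdot p : differentiable (fun y => gdot y y) p.
Proof.
under eq_fun do rewrite gdotE.
have h i : differentiable (fun y : 'rV[R]_7 => y 0 i * y 0 i) p.
  by apply: differentiableM; exact: differentiable_coord.
by do !apply: differentiableB => //; do !apply: differentiableD => //.
Qed.

Lemma retr_S p : S33 p -> retr p = p.
Proof. by rewrite /S33 /retr /= => ->; rewrite opprK sqrtr1 invr1 scale1r. Qed.

Lemma near_neg p : S33 p -> \forall y \near p, gdot y y < 0.
Proof.
move=> hp; have := differentiable_continuous (diff_gdot p).
move=> /(_ [set z | z < 0]); apply.
by apply: open_nbhs_nbhs; split; [exact: open_lt | rewrite /= hp; lra].
Qed.

Lemma retr_in y : gdot y y < 0 -> S33 (retr y).
Proof.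
move=> y0; rewrite /S33 /retr /=.
have h (k : R) : gdot (k *: y) (k *: y) = k ^+ 2 * gdot y y.
  by rewrite !gdotE !mxE; ring.
rewrite h exprVn sqr_sqrtr; last by lra.
by field; lra.
Qed.

Lemma diff_gdot_tangent p v : tangent p v -> 'd (fun y => gdot y y) p v = 0.
Proof.
move=> hv.
rewrite -deriveE; last exact: diff_gdot.
have e : (fun y : 'rV[R]_7 => gdot y y) \o shift p =
    fun y => gdot p p + 2 * gdot p y + gdot y y.
  by apply/funext => y /=; rewrite !gdotE !mxE; ring.
rewrite /derive; apply: cvg_lim => //.
have -> : (fun h : R => h^-1 *:
      (((fun y : 'rV[R]_7 => gdot y y) \o shift p) (h *: v) - gdot p p)) =
    fun h => h * gdot v v.
  apply/funext => h; rewrite e; have [->|h0] := eqVneq h 0.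
    by rewrite invr0 scale0r mul0r.
  have -> : gdot (h *: v) (h *: v) = h ^+ 2 * gdot v v.
    by rewrite !gdotE !mxE; ring.
  have -> : gdot p (h *: v) = h * gdot p v by rewrite !gdotE !mxE; ring.
  by rewrite hv /GRing.scale /=; field; exact: h0.
have H : (fun h : R => h * gdot v v) @ (0 : R) --> (0 : R).
  rewrite -[X in _ --> X](mul0r (gdot v v)).
  by apply: cvgMl; exact: cvg_id.
by apply: (cvg_trans _ H); apply: cvg_app; exact: cvg_within.
Qed.

Lemma diff_inv_sqrt (t : R) : t < 0 ->
  differentiable (fun s : R => (Num.sqrt (- s))^-1) t.
Proof.
move=> t0; apply: differentiableV; last by rewrite gt_eqF// sqrtr_gt0; lra.
apply: (@differentiable_comp _ _ _ _ -%R Num.sqrt).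
  exact: differentiableN.
by apply/derivable1_diffP; apply: ex_derive; apply: is_derive1_sqrt; lra.
Qed.

Lemma retr_diff p v : S33 p -> tangent p v ->
  differentiable retr p /\ 'd retr p v = v.
Proof.
move=> hp hv.
pose h (s : R) := (Num.sqrt (- s))^-1.
pose k (y : 'rV[R]_7) : R := h (gdot y y).
have dh : differentiable h (gdot p p) by apply: diff_inv_sqrt; rewrite hp; lra.
have dg := diff_gdot p.
have dk : differentiable k p.
  exact: (@differentiable_comp _ _ _ _ (fun y => gdot y y) h).
have k0 : 'd k p v = 0.
  have -> : k = h \o (fun y => gdot y y) by [].
  by rewrite diff_comp //= (diff_gdot_tangent hv) linear0.
have kp : k p = 1 by rewrite /k /h hp opprK sqrtr1 invr1.
pose e i : 'rV[R]_7 := delta_mx 0 i.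
pose G i : 'rV[R]_7 -> 'rV[R]_7 := fun y => (k y * y 0 i) *: e i.
pose dG i : 'rV[R]_7 -> 'rV[R]_7 :=
  fun w => (k p * w 0 i + p 0 i * 'd k p w) *: e i.
have retrE : retr = \sum_(i < 7) G i.
  apply/funext => y; rewrite fct_sumE /retr -/(h (gdot y y)) -/(k y).
  rewrite {2}[y]row_sum_delta scaler_sumr.
  by apply: eq_bigr => i _; rewrite scalerA.
have D i : is_diff p (G i) (dG i).
  have dc : is_diff p (fun y : 'rV[R]_7 => y 0 i : R) (fun y => y 0 i).
    have @f : {linear 'rV[R]_7 -> R}.
      by exists (fun N : 'rV[R]_7 => N 0 i); do 2![eexists]; do ?[constructor];
       rewrite ?mxE// => ? *; rewrite ?mxE//; move=> ?; rewrite !mxE.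
    apply: DiffDef; first exact: differentiable_coord.
    rewrite (_ : (fun _ => _) = f) //; apply: diff_lin; exact: coord_continuous.
  have [d1 d2] := is_diff_comp (is_diffM (differentiableP dk) dc)
                    (is_diff_scalel (k p * p 0 i) (e i)).
  apply: DiffDef; first exact: d1.
  rewrite (_ : 'd (G i) p = 'd (( *:%R^~ (e i)) \o
    (k * (fun y : 'rV[R]_7 => y 0 i : R))) p :> (_ -> _)); last by [].
  by rewrite d2.
have dsum (r : seq 'I_7) :
  is_diff p (\sum_(i <- r) G i) (\sum_(i <- r) dG i).
  elim: r => [|i r IH]; first by rewrite !big_nil; exact: is_diff_cst.
  by rewrite !big_cons; exact: is_diffD.
have [d1 d2] := dsum (index_enum _).
rewrite retrE; split; first exact: d1.
rewrite d2 fct_sumE [RHS]row_sum_delta.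
by apply: eq_bigr => i _; rewrite /dG k0 kp mulr0 addr0 mul1r.
Qed.

Lemma derS_ext (f F : 'rV[R]_7 -> 'rV[R]_7) p v :
  S33 p -> tangent p v -> differentiable F p ->
  (\forall y \near p, S33 y -> f y = F y) -> derS f p v = 'D_v F p.
Proof.
move=> hp hv dF fF; have [dr rv] := retr_diff hp hv.
have rp := retr_S hp.
have dF' : differentiable F (retr p) by rewrite rp.
have -> : derS f p v = 'D_v (F \o retr) p.
  apply: near_eq_derive.
  have : \forall y \near p, S33 (retr y) -> f (retr y) = F (retr y).
    have c : retr @ p --> p.
      by rewrite -[X in _ --> X]rp; exact: differentiable_continuous dr.
    exact: c fF.
  have := near_neg hp.
  by apply: filterS2 => y y0 h; exact: h (retr_in y0).
by rewrite (derive_comp v dr dF') rv rp.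
Qed.

(* The Lie bracket: [X, Y] phi = X (Y phi) - Y (X phi), with the seven
   coordinate functions for phi. *)
Definition bracket (X Y : 'rV[R]_7 -> 'rV[R]_7) (p : 'rV[R]_7) : 'rV[R]_7 :=
  derS Y p (X p) - derS X p (Y p).

Definition paraP (x Y : 'rV[R]_7) : 'rV[R]_7 := cross (nvec x) Y.

Definition Pfield (X : 'rV[R]_7 -> 'rV[R]_7) (p : 'rV[R]_7) : 'rV[R]_7 :=
  paraP p (X p).

Definition NP (X Y : 'rV[R]_7 -> 'rV[R]_7) (p : 'rV[R]_7) : 'rV[R]_7 :=
  2 *: (bracket X Y p + bracket (Pfield X) (Pfield Y) p
        - paraP p (bracket (Pfield X) Y p) - paraP p (bracket X (Pfield Y) p)).

(* w is the value on the tangent vectors u, v at x of the tensor T given on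
   vector fields: u, v extend to vector fields, and T takes the value w at x
   for all such extensions. *)
Definition tensor_value
    (T : ('rV[R]_7 -> 'rV[R]_7) -> ('rV[R]_7 -> 'rV[R]_7) ->
         'rV[R]_7 -> 'rV[R]_7)
    (x u v w : 'rV[R]_7) : Prop :=
  (exists X Y, [/\ vector_field X, vector_field Y, X x = u & Y x = v]) /\
  (forall X Y, vector_field X -> vector_field Y -> X x = u -> Y x = v ->
     T X Y x = w).

End PseudoSphere.

(* Main.v *)
Require Import Defs.
From HB Require Import structures.
From mathcomp Require Import all_boot all_order all_algebra.
From mathcomp Require Import all_classical all_reals all_analysis.
From mathcomp Require Import ring lra.
Import Order.TTheory GRing.Theory Num.Theory.
Import numFieldNormedType.Exports.

(** The proof is a computation with local extensions.  Near a point p of S33,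
    a field X is the restriction of a smooth map F of R^{3,4}, and PX is the
    restriction of y |-> y x F y.  As the cross product is bilinear, Leibniz
    gives, for w tangent at p and D the derivative of fields at p,
<<
      D_w (PX) = w x X + P (D_w X).
>>
    Substituting this in the four brackets of the Nijenhuis tensor, the terms
    with derivatives along PX and PY cancel and what is left is
<<
      N_P(X, Y) = 2 (Z - P^2 Z + PX x Y - PY x X - 2 P (X x Y)),
>>
    where Z = D_X Y - D_Y X = [X, Y].  Two facts about the cross product
    finish the computation.

    - P^2 z = z + g(p, z) p ([paraP_paraP]), and g(p, Z) = 0: differentiating
      g(y, F y) = 0 along S33 yields g(p, D_X Y) = - g(X, Y) = g(p, D_Y X)
      ([gdot_derS]).  So Z - P^2 Z = 0.
    - PX x Y - PY x X = - 2 P (X x Y) for X, Y orthogonal to p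
      ([cross_paraP]).  Up to multiples of the metric, the double product
      a x (b x c) is alternating in a, b, c: this is [cross_cross], the
      polarized form of a x (a x c) = g(a, c) a - g(a, a) c.

    Hence N_P(X, Y) = 2 (- 2 - 2) P (X x Y).

    There remains the existence of fields with a given value u at p: the
    tangential projection of u, y |-> u + g(y, u) y, is one.  It is quadratic,
    so both the Leibniz rule and smoothness are taken from general facts about
    bilinear maps on spaces of row vectors. *)

Set Implicit Arguments.
Unset Strict Implicit.
Unset Printing Implicit Defensive.
Local Open Scope classical_set_scope.
Local Open Scope ring_scope.

(** * Calculus of bilinear maps on row vectors *)

Section BilinearCalculus.
Context {R : realType} {m n : nat} {V W : normedModType R}.
Context (B : {bilinear 'rV[R]_m -> 'rV[R]_n -> W}).

(** In coordinates B is a finite sum of products of coordinates, times fixed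
    vectors. *)
Lemma bilinear_rV_continuous : continuous (fun q => B q.1 q.2).
Proof.
pose e k (i : 'I_k) : 'rV[R]_k := delta_mx 0 i.
pose c i j (q : 'rV[R]_m * 'rV[R]_n) :=
  (q.1 0 i * q.2 0 j) *: B (e m i) (e n j).
have -> : (fun q => B q.1 q.2) = fun q => \sum_(i < m) \sum_(j < n) c i j q.
  apply/funext => -[a b] /=.
  rewrite [in LHS](row_sum_delta a) linear_sumlz.
  apply: eq_bigr => i _.
  rewrite [in LHS](row_sum_delta b) linear_sumr.
  by apply: eq_bigr => j _; rewrite linearZr_LR linearZl_LR scalerA mulrC.
move=> q; apply: (cvg_big add_continuous) => i _.
apply: (cvg_big add_continuous) => j _.
apply: cvgZr_tmp; apply: cvgM.
  apply: (@cvg_comp _ _ _ fst (fun a : 'rV_m => a 0 i)); first exact: cvg_fst.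
  exact: coord_continuous.
apply: (@cvg_comp _ _ _ snd (fun a : 'rV_n => a 0 j)); first exact: cvg_snd.
exact: coord_continuous.
Qed.

(** The Leibniz rule for B. *)
Lemma diff_bilinear_rV (f : V -> 'rV[R]_m) (g : V -> 'rV[R]_n) y :
  differentiable f y -> differentiable g y ->
  differentiable (fun z => B (f z) (g z)) y /\
  forall w, 'D_w (fun z => B (f z) (g z)) y =
            B ('D_w f y) (g y) + B (f y) ('D_w g y).
Proof.
move=> df dg; pose h z := (f z, g z).
have dh : differentiable h y by exact: differentiable_pair.
have dB q : differentiable (fun q => B q.1 q.2) q.
  exact/differentiable_bilin/bilinear_rV_continuous.
split; first exact: (differentiable_comp dh (dB _)).
move=> w; rewrite (derive_comp w dh (dB _)) (deriveE _ (dB _)).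
rewrite diff_bilin; last exact: bilinear_rV_continuous.
by rewrite diff_pair//= addrC !deriveE.
Qed.
End BilinearCalculus.

(** * Smooth maps on the whole space *)

Section SmoothOnSpace.
Context {R : realType}.

Lemma Ck_onW {V W : normedModType R} k (f : V -> W) :
  Ck_on k.+1 setT f -> Ck_on k setT f.
Proof.
elim: k f => [|k IH] f [df Df].
  by move=> y _; apply: differentiable_continuous; exact: df.
by split=> // v; apply: IH.
Qed.

Lemma Ck_onD {V W : normedModType R} k (f g : V -> W) :
  Ck_on k setT f -> Ck_on k setT g -> Ck_on k setT (fun y => f y + g y).
Proof.
elim: k f g => [|k IH] f g.
  by move=> cf cg y _; apply: cvgD; [exact: cf | exact: cg].
move=> [df Df] [dg Dg]; split=> [y _|v].
  by apply: differentiableD; [exact: df | exact: dg].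
have -> : (fun y => 'D_v (fun z => f z + g z) y) =
    fun y => 'D_v f y + 'D_v g y.
  apply/funext => y; rewrite -deriveD//; apply: diff_derivable.
    exact: df.
  exact: dg.
by apply: IH; [exact: Df | exact: Dg].
Qed.

Lemma Ck_on_cst {V W : normedModType R} k (c : W) :
  Ck_on k setT (fun _ : V => c).
Proof.
elim: k c => [|k IH] c; first by move=> y _; exact: cvg_cst.
split=> // v.
have -> : (fun y => 'D_v (fun _ : V => c) y) = fun=> 0.
  by apply/funext => y; rewrite derive_cst.
exact: IH.
Qed.

Lemma Ck_on_id {V : normedModType R} k : Ck_on k setT (fun y : V => y).
Proof.
case: k => [|k]; first by move=> y _; exact: cvg_id.
split=> // v.
have -> : (fun y => 'D_v (fun z : V => z) y) = fun=> v.
  by apply/funext => y; rewrite derive_id.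
exact: Ck_on_cst.
Qed.

(** By the Leibniz rule the derivative of B f g has the same form, so
    regularity goes up by induction. *)
Lemma Ck_on_bilinear {m n : nat} {V W : normedModType R}
    (B : {bilinear 'rV[R]_m -> 'rV[R]_n -> W}) k f g :
  Ck_on k setT f -> Ck_on k setT g ->
  Ck_on k setT (fun y : V => B (f y) (g y)).
Proof.
elim: k f g => [|k IH] f g.
  move=> cf cg y _.
  apply: (@continuous_comp _ _ _ (fun z => (f z, g z)) (fun q => B q.1 q.2)).
    exact: (cvg_pair (cf y I) (cg y I)).
  exact: bilinear_rV_continuous.
move=> cf cg; have [df Df] := cf; have [dg Dg] := cg; split=> [y _|v].
  by have [] := diff_bilinear_rV B (df y I) (dg y I).
have -> : (fun y => 'D_v (fun z => B (f z) (g z)) y) =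
    fun y => B ('D_v f y) (g y) + B (f y) ('D_v g y).
  apply/funext => y.
  by have [_ ->] := diff_bilinear_rV B (df y I) (dg y I).
by apply: Ck_onD; apply: IH;
  [exact: Df | exact: Ck_onW cg | exact: Ck_onW cf | exact: Dg].
Qed.

End SmoothOnSpace.

(** * Algebra of the cross product *)

Section CrossProduct.
Context {R : realType}.
Implicit Types a b p u v w z : 'rV[R]_7.

Lemma row7P a b :
  [/\ a 0 0 = b 0 0, a 0 1 = b 0 1, a 0 2 = b 0 2 & a 0 3 = b 0 3] ->
  [/\ a 0 4 = b 0 4, a 0 5 = b 0 5 & a 0 6 = b 0 6] -> a = b.
Proof.
move=> [e0 e1 e2 e3] [e4 e5 e6]; apply/rowP => -[i].
do 7?[case: i => [|i]] => // hi.
- by move: e0; congr (a _ _ = b _ _); exact: val_inj.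
- by move: e1; congr (a _ _ = b _ _); exact: val_inj.
- by move: e2; congr (a _ _ = b _ _); exact: val_inj.
- by move: e3; congr (a _ _ = b _ _); exact: val_inj.
- by move: e4; congr (a _ _ = b _ _); exact: val_inj.
- by move: e5; congr (a _ _ = b _ _); exact: val_inj.
- by move: e6; congr (a _ _ = b _ _); exact: val_inj.
Qed.

(** Entries of sums, opposites and multiples only: [mxE] would also unfold the
   cross products. *)
Lemma addmxE m n (A B : 'M[R]_(m, n)) i j : (A + B) i j = A i j + B i j.
Proof. by rewrite mxE. Qed.
Lemma oppmxE m n (A : 'M[R]_(m, n)) i j : (- A) i j = - A i j.
Proof. by rewrite mxE. Qed.
Lemma scalemxE m n k (A : 'M[R]_(m, n)) i j : (k *: A) i j = k * A i j.
Proof. by rewrite mxE. Qed.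

Lemma caImE (x : @cayley R) :
  ((caIm x 0 0 = x.1 0 1) * (caIm x 0 1 = x.1 0 2) * (caIm x 0 2 = x.1 0 3) *
   (caIm x 0 3 = x.2 0 0) * (caIm x 0 4 = x.2 0 1) * (caIm x 0 5 = x.2 0 2) *
   (caIm x 0 6 = x.2 0 3))%type.
Proof. by rewrite !mxE. Qed.

Lemma crossE a b :
  ((cross a b 0 0 = (a 0 1 * b 0 2 - a 0 2 * b 0 1 + a 0 4 * b 0 3
                    - a 0 3 * b 0 4 - a 0 6 * b 0 5 + a 0 5 * b 0 6)%R) *
   (cross a b 0 1 = (a 0 2 * b 0 0 - a 0 0 * b 0 2 + a 0 5 * b 0 3
                    + a 0 6 * b 0 4 - a 0 3 * b 0 5 - a 0 4 * b 0 6)%R) *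
   (cross a b 0 2 = (a 0 0 * b 0 1 - a 0 1 * b 0 0 + a 0 6 * b 0 3
                    - a 0 5 * b 0 4 + a 0 4 * b 0 5 - a 0 3 * b 0 6)%R) *
   (cross a b 0 3 = (a 0 4 * b 0 0 + a 0 5 * b 0 1 + a 0 6 * b 0 2
                    - a 0 0 * b 0 4 - a 0 1 * b 0 5 - a 0 2 * b 0 6)%R) *
   (cross a b 0 4 = (a 0 0 * b 0 3 + a 0 2 * b 0 5 - a 0 1 * b 0 6
                    - a 0 3 * b 0 0 - a 0 5 * b 0 2 + a 0 6 * b 0 1)%R) *
   (cross a b 0 5 = (a 0 1 * b 0 3 - a 0 2 * b 0 4 + a 0 0 * b 0 6
                    - a 0 3 * b 0 1 + a 0 4 * b 0 2 - a 0 6 * b 0 0)%R) *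
   (cross a b 0 6 = (a 0 2 * b 0 3 + a 0 1 * b 0 4 - a 0 0 * b 0 5
                    - a 0 3 * b 0 2 - a 0 4 * b 0 1 + a 0 5 * b 0 0)%R))%type.
Proof.
rewrite /cross !caImE /camul /ofIm /= !addmxE /qmul !mkquatE.
rewrite /qconj ?mkquatE.
by do !split; ring.
Qed.

Lemma cross_bilinear : bilinear_for
  (GRing.Scale.Law.clone _ _ *:%R _) (GRing.Scale.Law.clone _ _ *:%R _)
  (@cross R).
Proof.
by split=> [b|a] k u v; apply: row7P; split;
  rewrite !(addmxE, scalemxE, crossE) /=; ring.
Qed.

HB.instance Definition _ := bilinear_isBilinear.Build R _ _ _ _ _ (@cross R)
  cross_bilinear.

(** The metric as a bilinear map, with values on the line of w instead of in R:
    derivatives on S33 are defined for maps into R^{3,4}. *)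
Definition gdot_scale w a b : 'rV[R]_7 := gdot a b *: w.

Lemma gdot_scale_bilinear w : bilinear_for
  (GRing.Scale.Law.clone _ _ *:%R _) (GRing.Scale.Law.clone _ _ *:%R _)
  (gdot_scale w).
Proof.
by split=> [b|a] k u v; rewrite /= /gdot_scale scalerA -scalerDl !gdotE;
  congr (_ *: _); rewrite !(addmxE, scalemxE); ring.
Qed.

HB.instance Definition _ w := bilinear_isBilinear.Build R _ _ _ _ _
  (gdot_scale w) (gdot_scale_bilinear w).

(** On the diagonal this is the quadratic part of the tangential projection
    y |-> u + gdot y u *: y of u. *)
Definition gdot_mul u a b : 'rV[R]_7 := gdot a u *: b.

Lemma gdot_mul_bilinear w : bilinear_for
  (GRing.Scale.Law.clone _ _ *:%R _) (GRing.Scale.Law.clone _ _ *:%R _)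
  (gdot_mul w).
Proof.
by split=> [b|a] k u v; apply: row7P; split;
  rewrite /= /gdot_mul !gdotE !(addmxE, scalemxE); ring.
Qed.

HB.instance Definition _ w := bilinear_isBilinear.Build R _ _ _ _ _
  (gdot_mul w) (gdot_mul_bilinear w).

Lemma gdotC a b : gdot a b = gdot b a.
Proof. by rewrite !gdotE; ring. Qed.

Lemma crossC a b : cross a b = - cross b a.
Proof. by apply: row7P; split; rewrite !(oppmxE, crossE); ring. Qed.

Lemma gdot_cross a b : gdot a (cross a b) = 0.
Proof. by rewrite gdotE !crossE; ring. Qed.

(** The double product is alternating modulo the metric.  This polarizes
    a x (a x w) = g(a, w) a - g(a, a) w, which expresses the alternativity of
    the Cayley algebra. *)
Lemma cross_cross a b w : cross a (cross b w) =
  - cross b (cross a w)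
  + (gdot a w *: b + gdot b w *: a - (2 * gdot a b) *: w).
Proof.
by apply: row7P; split;
  rewrite !(addmxE, oppmxE, scalemxE, crossE, gdotE); ring.
Qed.

(** On S33, P^2 is the projection onto the tangent space: it is the identity on
    tangent vectors and kills p.  The identity [cross_cross] with a = b = p
    gives twice this. *)
Lemma paraP_paraP p w : S33 p -> paraP p (paraP p w) = w + gdot p w *: p.
Proof.
rewrite /S33 /= /paraP /nvec => hp.
apply/rowP => i; have /(congr1 (fun A : 'rV_7 => A 0 i)) := cross_cross p p w.
by rewrite !(addmxE, oppmxE, scalemxE) hp; lra.
Qed.

(** Both products on the left are of the form a x (b x c) up to sign, and
    exchanging p with the first factor by [cross_cross] turns them into
    - P (u x v) - g(u, v) p and P (u x v) - g(u, v) p: the metric terms cancel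
    in the difference. *)
Lemma cross_paraP p u v : tangent p u -> tangent p v ->
  cross (paraP p u) v - cross (paraP p v) u = - 2 *: paraP p (cross u v).
Proof.
rewrite /tangent /paraP /nvec /= => pu pv.
rewrite (crossC (cross p u)) (crossC (cross p v)).
rewrite (cross_cross v) (cross_cross u).
rewrite (crossC v u) linearNr (gdotC v p) (gdotC u p) pu pv (gdotC v u).
by apply/rowP => i; rewrite !(addmxE, oppmxE, scalemxE); ring.
Qed.

End CrossProduct.

(** * Derivatives of fields on the pseudosphere *)

Section Derivatives.
Context {R : realType}.
Implicit Types (X Y : 'rV[R]_7 -> 'rV[R]_7) (p u v w : 'rV[R]_7).

Lemma smooth_S33_extension X p : smooth_S33 X -> S33 p ->
  exists2 F, differentiable F p & \forall y \near p, S33 y -> X y = F y.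
Proof.
move=> sX hp; have [U [F [oU Up sF XF]]] := sX p hp.
exists F; first by have [dF _] := sF 1%N; exact: dF.
by apply: filterS (open_nbhs_nbhs (conj oU Up)) => y; exact: XF.
Qed.

Lemma derS_bilinear (B : {bilinear 'rV[R]_7 -> 'rV[R]_7 -> 'rV[R]_7}) X p w :
  smooth_S33 X -> S33 p -> tangent p w ->
  derS (fun y => B y (X y)) p w = B w (X p) + B p (derS X p w).
Proof.
move=> sX hp hw; have [F dF XF] := smooth_S33_extension sX hp.
have dp : differentiable (fun y : 'rV[R]_7 => y) p by [].
have [dB DB] := diff_bilinear_rV B dp dF.
rewrite (derS_ext hp hw dF XF) (derS_ext hp hw dB); last first.
  by apply: filterS XF => y XF hy; rewrite XF.
by rewrite DB derive_id (nbhs_singleton XF hp).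
Qed.

Lemma derS_Pfield X p w : smooth_S33 X -> S33 p -> tangent p w ->
  derS (Pfield X) p w = cross w (X p) + paraP p (derS X p w).
Proof. exact: (derS_bilinear (@cross R)). Qed.

(** The derivative of g(y, X y), which vanishes on S33.  It is taken after
    multiplication by p, a nonzero vector. *)
Lemma gdot_derS X p w : vector_field X -> S33 p -> tangent p w ->
  gdot p (derS X p w) = - gdot w (X p).
Proof.
move=> [sX tX] hp hw.
have : derS (fun y => gdot_scale p y (X y)) p w = 0.
  rewrite (derS_ext (F := fun=> 0) hp hw) ?derive_cst//.
  by apply: filterE => y hy; rewrite /gdot_scale (tX y hy) scale0r.
rewrite derS_bilinear // /gdot_scale -scalerDl => /eqP.
rewrite scaler_eq0 => /orP[/eqP e|/eqP p0]; first by lra.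
by move: hp; rewrite /S33 p0 /= gdotE !mxE; lra.
Qed.

(** The orthogonal projections of u to the tangent spaces form such a field;
    since g(y, y) = - 1, the projection at y is u + g(y, u) y. *)
Lemma tangent_field p u : tangent p u ->
  exists2 X, vector_field X & X p = u.
Proof.
move=> pu; exists (fun y => u + gdot_mul u y y); last first.
  by rewrite /gdot_mul pu scale0r addr0.
split=> y hy.
  exists setT, (fun y => u + gdot_mul u y y); split=> //; first exact: openT.
  move=> k; apply: Ck_onD; first exact: Ck_on_cst.
  by apply: Ck_on_bilinear; exact: Ck_on_id.
rewrite /tangent /= /gdot_mul.
have -> : gdot y (u + gdot y u *: y) = gdot y u * (1 + gdot y y).
  by rewrite !gdotE !mxE; ring.
by rewrite hy subrr mulr0.
Qed.

(** Leibniz in each bracket, then [paraP_paraP], [gdot_derS] and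
    [cross_paraP]. *)
Lemma NP_cross X Y p : vector_field X -> vector_field Y -> S33 p ->
  NP X Y p = - 8 *: paraP p (cross (X p) (Y p)).
Proof.
move=> fX fY hp; have [[sX tX] [sY tY]] := (fX, fY).
have [tu tv] := (tX p hp, tY p hp).
have tPu : tangent p (Pfield X p) by exact: gdot_cross.
have tPv : tangent p (Pfield Y p) by exact: gdot_cross.
rewrite /NP /bracket !derS_Pfield // /Pfield.
have PD a b : paraP p (a + b) = paraP p a + paraP p b by exact: linearDr.
have PN a : paraP p (- a) = - paraP p a by exact: linearNr.
have PP a := paraP_paraP a hp.
have := gdot_derS fX hp tv; have := gdot_derS fY hp tu.
have := cross_paraP tu tv; rewrite (crossC (Y p) (X p)) (gdotC (Y p) (X p)).
(* What remains only uses that P is linear, so P and the derivatives become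
   variables. *)
move: (derS X p (Y p)) (derS Y p (X p)) (derS X p (paraP p (Y p)))
  (derS Y p (paraP p (X p))) (paraP p) PD PN PP.
move=> a b a' b' P PD PN PP Puv gb ga.
rewrite -[cross (P (X p)) _](subrK (cross (P (Y p)) (X p))) Puv.
rewrite !(PD, PN) !PP gb ga.
move: (cross (X p) (Y p)) (cross (P (Y p)) (X p)) (gdot (X p) (Y p)) => c d k.
by apply/rowP => i; rewrite !mxE; ring.
Qed.

End Derivatives.

Theorem theorem5p3 (R : realType) (x u v : 'rV[R]_7)
    (hx : S33 x) (hu : tangent x u) (hv : tangent x v) :
  tensor_value NP x u v (- 8 *: cross (nvec x) (cross u v)) /\
  - 8 *: cross (nvec x) (cross u v) = - 8 *: paraP x (cross u v).
Proof.
split=> //; split=> [|X Y fX fY <- <-]; last exact: NP_cross.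
have [[X fX Xx] [Y fY Yx]] := (tangent_field hu, tangent_field hv).
by exists X, Y.
Qed.
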